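(* Let $K\ge 2$, $N\ge K$ and $\alpha_{\max}\in\{1,\ldots,\lfloor K/2\rfloor\}$ be integers, and consider the $K$-user caching network with user cooperation described in the context. For memory size $0\le M\le N$, the optimal transmission delay $R^*$ is lower bounded by $$R^*\ \ge\ \max\left\{\frac12\Big(1-\frac MN\Big),\ \max_{s\in[K]}\Big(s-\frac{KM}{\lfloor N/s\rfloor}\Big),\ \max_{s\in[K]}\Big(s-\frac{sM}{\lfloor N/s\rfloor}\Big)\frac{1}{1+\alpha_{\max}}\right\}.$$
   Context: Notation: $[m]\triangleq\{1,\ldots,m\}$. Network: a server is connected to $K$ users by a noiseless shared link, and the users can communicate with each other through a noiseless cooperation network. The server has $N$ independent files $W_1,\ldots,W_N$, each uniformly distributed over $[2^F]$, $F$ a positive integer. Each user has a cache memory of $MF$ bits, $M\in[0,N]$. Cooperation network: the integer $\alpha_{\max}$ is the maximum number of users allowed to send data in parallel in the cooperation network. Users can receive signals interference-free from the server and other users simultaneously. Each user can receive data from at most one user, and a user that sends data cannot simultaneously receive data transmitted by other users. The network is flexible: each user can flexibly select a subset of users to cooperate with, and the subset can be changed during the transmission. Let the positive integer $\alpha\le\alpha_{\max}$ denote the number of users that exactly send information in parallel during the data transmission. The $K$ users can be partitioned into $\alpha$ groups $\mathcal G_1,\ldots,\mathcal G_\alpha\subseteq[K]$, pairwise disjoint with union $[K]$; in each group $\mathcal G_j$ a user $u_j$ is allowed to send data to all other users in $\mathcal G_j$. The groups $\mathcal G_j$ and the users $u_j$ can be changed during the delivery phase. Placement phase: user $k\in[K]$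 stores $Z_k=\phi_k(W_1,\ldots,W_N)$ for a caching function $\phi_k:[2^F]^N\to[\lfloor 2^{MF}\rfloor]$. Delivery phase: user $k$ requests file $W_{d_k}$, $d_k\in[N]$; the request vector $\mathbf d=(d_1,\ldots,d_K)$ is made known to the server and all users. The server produces $X=f_{\mathbf d}(W_1,\ldots,W_N)$, received by all users, and user $k$ produces $X_k=f_{k,\mathbf d}(Z_k)$, for encoding functions $f_{\mathbf d}:[2^F]^N\to[\lfloor 2^{R_1F}\rfloor]$ and $f_{k,\mathbf d}:[\lfloor 2^{MF}\rfloor]\to[\lfloor 2^{R_2F}\rfloor]$, where $R_1$ and $R_2$ denote the rates transmitted by the server and by each user, respectively. User $k$ perfectly observes the signals sent to it and decodes $\hat W_{d_k}=\psi_{k,\mathbf d}(X,Y_k,Z_k)$, where $Y_k\in\{X_1,\ldots,X_K\}$ denotes user $k$'s received signal sent from other users and $\psi_{k,\mathbf d}:[\lfloor 2^{R_1F}\rfloor]\times[\lfloor 2^{R_2F}\rfloor]\times[\lfloor 2^{MF}\rfloor]\to[2^F]$ is a decoding function. The worst-case probability of error is $P_e=\max_{\mathbf d\in[N]^K}\max_{k\in[K]}\Pr(\hat W_{d_k}\ne W_{d_k})$. A caching scheme $(M,R_1,R_2)$ consists of such caching, encoding and decoding functions. The triple $(M,R_1,R_2)$ is achievable if for every $\epsilon>0$ and every large enough $F$ there exists a caching scheme with $P_e<\epsilon$. The transmission delay of an achievable triple is $R\triangleq\max\{R_1,R_2\}$, and the optimal transmission delay (for given $M$) is $R^*\triangleq\inf\{R\}$.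 *)

(* Defs.v *)
From mathcomp Require Import all_boot all_order all_algebra.
From mathcomp Require Import all_classical all_reals all_analysis.
Set Implicit Arguments.
Unset Strict Implicit.
Unset Printing Implicit Defensive.
Import Order.TTheory GRing.Theory Num.Theory.
Local Open Scope ring_scope.

(* floor (2 ^ (r F)), the number of messages at rate r; [r] may be any real,
   since 2 `^ (r F) > 0. *)
Definition nmsg (R : realType) (r : R) (F : nat) : nat :=
  Num.truncn (2 `^ (r * F%:R)).

Definition files (N F : nat) := {ffun 'I_N -> 'I_(2 ^ F)}.

Definition demand (K N : nat) := {ffun 'I_K -> 'I_N}.

(* The partition into groups and the senders may change during the delivery, so
   the cooperation network is used over [nslot] time slots.  In each slot a
   sender transmits one symbol of an alphabet of size [nsym], and the complete
   signal X_k is the sequence of the symbols of user k; [slot_rate] makes this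
   a message of rate R2, which therefore also measures the time during which
   the cooperation network is in use.  One slot with nsym = nmsg R2 F is
   delivery with fixed groups; nsym = 2 lets the groups change at every bit.

   In slot t the groups are the fibres of [group t], and [sender t j] is the
   only user of group j who transmits.  The groups are nonempty by
   [sender_group]. *)
Record delivery (R : realType) (K N amax F : nat) (M R1 R2 : R) := Delivery {
  nactive : nat;
  nactive_gt0 : (0 < nactive)%N;
  nactive_le : (nactive <= amax)%N;
  nslot : nat;
  nsym : nat;
  slot_rate : (nsym ^ nslot <= nmsg R2 F)%N;
  group : 'I_nslot -> 'I_K -> 'I_nactive;
  sender : 'I_nslot -> 'I_nactive -> 'I_K;
  sender_group : forall t j, group t (sender t j) = j;
  server_enc : files N F -> 'I_(nmsg R1 F);
  user_enc : 'I_K -> 'I_(nmsg M F) -> {ffun 'I_nslot -> 'I_nsym};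
  decoder : 'I_K -> 'I_(nmsg R1 F) -> {ffun 'I_nslot -> 'I_nsym} ->
            'I_(nmsg M F) -> 'I_(2 ^ F)
}.

Arguments group {R K N amax F M R1 R2} d t k : rename.
Arguments sender {R K N amax F M R1 R2} d t j : rename.
Arguments decoder {R K N amax F M R1 R2} d k x y z : rename.

Record scheme (R : realType) (K N amax F : nat) (M R1 R2 : R) := Scheme {
  caching : 'I_K -> files N F -> 'I_(nmsg M F);
  deliver : demand K N -> delivery K N amax F M R1 R2
}.

Section SchemeSemantics.
Variables (R : realType) (K N amax F : nat) (M R1 R2 : R).
Variable S : scheme K N amax F M R1 R2.

Definition cache (W : files N F) (k : 'I_K) := caching S k W.

Definition server_signal (d : demand K N) (W : files N F) :=
  server_enc (deliver S d) W.

Definition user_signal (d : demand K N) (W : files N F) (k : 'I_K) :=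
  user_enc (deliver S d) k (cache W k).

(* In each slot a user receives the symbol of the sender of its own group.  For
   that sender this is its own symbol, a function of its own cache: a
   transmitting user receives nothing from the others. *)
Definition received (d : demand K N) (W : files N F) (k : 'I_K) :=
  let D := deliver S d in
  [ffun t => user_signal d W (sender D t (group D t k)) t] :
    {ffun 'I_(nslot D) -> 'I_(nsym D)}.

Definition decoded (d : demand K N) (W : files N F) (k : 'I_K) : 'I_(2 ^ F) :=
  decoder (deliver S d) k (server_signal d W) (received d W k) (cache W k).

(* Independent uniform files are a uniform element of [files N F]. *)
Definition error_prob (d : demand K N) (k : 'I_K) : R :=
  #|[set W : files N F | decoded d W k != W (d k)]|%:R / #|files N F|%:R.

Definition worst_error : R :=
  \big[Num.max/0]_(d : demand K N) \big[Num.max/0]_(k < K) error_prob d k.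

End SchemeSemantics.

Definition achievable (R : realType) (K N amax : nat) (M R1 R2 : R) : Prop :=
  forall eps : R, 0 < eps -> exists F0 : nat, forall F : nat,
    (0 < F)%N -> (F0 <= F)%N ->
    exists S : scheme K N amax F M R1 R2, worst_error S < eps.

Definition optimal_delay (R : realType) (K N amax : nat) (M : R) : \bar R :=
  ereal_inf [set r | exists R1 R2 : R,
    achievable K N amax M R1 R2 /\ r = (Num.max R1 R2)%:E]%classic.

(* Main.v *)
Require Import Defs.
From mathcomp Require Import all_boot all_order all_algebra.
From mathcomp Require Import all_classical all_reals all_analysis.
From mathcomp Require Import ring lra.
Set Implicit Arguments.
Unset Strict Implicit.
Unset Printing Implicit Defensive.
Import Order.TTheory GRing.Theory Num.Theory.
Local Open Scope ring_scope.

(* Cut-set argument: s users that issue b := floor (N / s) successive demand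
   vectors for pairwise distinct files recover s b files from the signals of
   the b deliveries and from some caches.  By a union bound, when the error
   probability is small, at least half of the file tuples have all of these
   files decoded correctly; such a tuple is determined by its N - s b other
   files and the signals and caches used, so the latter take at least
   2 ^ (s b F - 1) values.  Letting F grow gives
   s b <= b (R1 + c R2) + m M, where m caches are used and each delivery
   contributes c user signals.  The three bounds are the cases
   (c, m) = (1, 1) for one user (s = 1), (0, K), since all the caches together
   determine every user signal, and (amax, s), since at most amax users send in
   each slot. *)

Lemma card_fprod_le (J : finType) (A : J -> finType) (L : nat) :
  (forall j, #|A j| <= L)%N -> (#|fprod A| <= L ^ #|J|)%N.
Proof.
by move=> AL; rewrite card_fprod -prod_nat_const; apply: leq_prod => j _.
Qed.

(** * Counting file tuples that are decoded correctly *)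

Section Recovery.
Variables (R : realType) (N F : nat) (P T : finType).
Variables (idx : P -> 'I_N) (info : files N F -> T).
Variable dec : P -> T -> 'I_(2 ^ F).
Hypothesis idx_inj : injective idx.

Let wrong p := [set W : files N F | dec p (info W) != W (idx p)].

Let recovered := [set W | [forall p, dec p (info W) == W (idx p)]].

Let rest := {j : 'I_N | j \notin codom idx}.

(** On [recovered], the map to [info] and the files outside [codom idx] is injective: every other
    file can be read off by [dec]. As [idx] is injective, exactly [N - #|P|] files lie outside. *)
Lemma card_recovered :
  (#|recovered| <= #|T| * 2 ^ (F * (N - #|P|)))%N.
Proof.
have -> : (N - #|P| = #|{: rest}|)%N.
  rewrite card_sig -(card_codom idx_inj) -[X in (X - _)%N](card_ord N).
  by rewrite -(cardC (mem (codom idx))) addKn.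
rewrite expnM.
have -> : ((2 ^ F) ^ #|{: rest}| = #|{ffun rest -> 'I_(2 ^ F)}|)%N.
  by rewrite card_ffun card_ord.
rewrite -card_prod.
pose h (W : files N F) : T * {ffun rest -> 'I_(2 ^ F)} :=
  (info W, [ffun j : rest => W (val j)]).
apply: (@leq_card_in _ _ h) => V W; rewrite !inE.
move=> /forallP hV /forallP hW [eVW /ffunP eR]; apply/ffunP => j.
have [/codomP[p ->]|jP] := boolP (j \in codom idx).
  by rewrite -(eqP (hV p)) -(eqP (hW p)) eVW.
by have := eR (Sub j jP); rewrite !ffunE.
Qed.

Lemma union_bound :
  (#|files N F| <= #|recovered| + \sum_p #|wrong p|)%N.
Proof.
have sub : ~: recovered \subset \bigcup_p wrong p.
  apply/fintype.subsetP => W; rewrite !inE negb_forall => /existsP[p hp].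
  by apply/finset.bigcupP; exists p; rewrite ?inE.
rewrite -(cardsC recovered) leq_add2l.
apply: leq_trans (subset_leq_card sub) _.
elim/big_rec2 : _ => [|p m A _ hA]; first by rewrite cards0.
by apply: leq_trans (leq_card_setU _ _) _; rewrite leq_add2l.
Qed.

Lemma leq_recovery (e : R) :
  (forall p, #|wrong p|%:R <= e * #|files N F|%:R) ->
  (1 - #|P|%:R * e) * (2 ^ (F * #|P|))%:R <= #|T|%:R.
Proof.
move=> he.
have cardF : (#|files N F| = 2 ^ (F * #|P|) * 2 ^ (F * (N - #|P|)))%N.
  rewrite /files card_ffun !card_ord -expnM -expnD -mulnDr subnKC//.
  by rewrite -[leqRHS]card_ord; exact: leq_card idx_inj.
have q0 : 0 < (2 ^ (F * (N - #|P|)))%:R :> R by rewrite ltr0n expn_gt0.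
(* Multiplying by the number of values of the remaining files turns the claim into a lower bound on
   the count in [card_recovered]. *)
rewrite -(ler_pM2r q0) -mulrA -!natrM -cardF.
rewrite mulrBl mul1r lerBlDr.
apply: (@le_trans _ _ (#|recovered| + \sum_p #|wrong p|)%:R).
  by rewrite ler_nat union_bound.
rewrite natrD lerD ?ler_nat ?card_recovered//.
rewrite natr_sum -mulrA mulr_natl -sumr_const.
by apply: ler_sum => p _; exact: he.
Qed.

End Recovery.

(** * The cut-set inequality for one scheme *)

Section Cutset.
Variables (R : realType) (K N amax F : nat) (M R1 R2 : R).
Variable S : scheme K N amax F M R1 R2.

Lemma error_prob_le d k : error_prob S d k <= worst_error S.
Proof.
rewrite /worst_error.
apply: le_trans (le_bigmax _ (fun d => \big[Num.max/0]_k error_prob S d k) d).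
exact: le_bigmax.
Qed.

Lemma worst_error_ge0 : 0 <= worst_error S.
Proof. by rewrite /worst_error; apply: bigmax_ge_id. Qed.

(** Caches are filled before the demands are known, so all deliveries share them and [#|C|] enters
    once, while the signals enter once per delivery. The type [A j] depends on [j] because slots and
    symbols may differ between deliveries; hence the dependent product and the common bound [L]. *)
Lemma leq_cutset (J I C : finType) (A : J -> finType) (L : nat)
    (dem : J -> demand K N) (usr : I -> 'I_K)
    (info : forall j, files N F -> A j) (caches : files N F -> C)
    (dec : forall j, I -> A j -> C -> 'I_(2 ^ F)) :
  injective (fun p : J * I => dem p.1 (usr p.2)) ->
  (forall j i W, decoded S (dem j) W (usr i) = dec j i (info j W) (caches W)) ->
  (forall j, #|A j| <= L)%N ->
  (1 - (#|J| * #|I|)%:R * worst_error S) * (2 ^ (F * (#|J| * #|I|)))%:R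
    <= (#|C| * L ^ #|J|)%:R :> R.
Proof.
move=> dem_inj decE AL.
have files_gt0 : (0 : R) < #|files N F|%:R.
  by rewrite /files card_ffun !card_ord ltr0n !expn_gt0.
pose dec' (p : J * I) (x : C * fprod A) := dec p.1 p.2 (x.2 p.1) x.1.
pose info' W : C * fprod A := (caches W, [fprod j => info j W]).
apply: le_trans (_ : _ <= #|{: C * fprod A}|%:R) _; last first.
  by rewrite ler_nat card_prod leq_mul2l card_fprod_le ?orbT.
rewrite -card_prod.
apply: (@leq_recovery _ _ _ _ _ _ info' dec' dem_inj) => -[j i] /=.
rewrite -ler_pdivrMr//; apply: le_trans (error_prob_le (dem j) (usr i)).
rewrite /error_prob ler_pM2r ?invr_gt0// ler_nat.
apply/subset_leq_card/fintype.subsetP => W.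
by rewrite !inE decE /dec' /info' /= fprodE.
Qed.

End Cutset.

(** * From message counts to rates as [F] grows *)

Section Rates.
Variable R : realType.

Lemma nmsg_le (r : R) F : (nmsg r F)%:R <= 2 `^ (r * F%:R).
Proof. by rewrite /nmsg truncn_le powR_ge0. Qed.

(** The factor 1/2 costs a single bit: logarithms give [n F - 1 <= r F], and the loss vanishes after
    division by [F]. *)
Lemma rate_le (n : nat) (r : R) (F0 : nat) :
  (forall F, (0 < F)%N -> (F0 <= F)%N ->
    2^-1 * (2 ^ (F * n))%:R <= 2 `^ (r * F%:R)) ->
  n%:R <= r.
Proof.
move=> h; rewrite leNgt; apply/negP => rn.
have rn0 : 0 < n%:R - r by rewrite subr_gt0.
have ln2 : 0 < ln 2 :> R by rewrite ln_gt0// ltr1n.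
(* If [r < n], this [F] is past [F0] and satisfies [(n - r) F > 1], against [n F - 1 <= r F]. *)
pose F := (maxn F0 (Num.truncn (n%:R - r)^-1)).+1.
have : (n%:R - r)^-1 < F%:R.
  apply: lt_le_trans (truncnS_gt _) _.
  by rewrite ler_nat ltnS leq_maxr.
have := h F isT (leqW (leq_maxl _ _)).
have two0 : 0 < 2 :> R by rewrite ltr0n.
have -> : 2^-1 * (2 ^ (F * n))%:R = 2 `^ ((F * n)%:R - 1) :> R.
  rewrite powRB ?pnatr_eq0 ?implybT// powRr1 ?ltW// powR_mulrn ?ltW//.
  by rewrite natrX mulrC.
rewrite -ler_ln ?posrE ?powR_gt0// !ln_powR ler_pM2r//.
rewrite natrM => h1; rewrite ltNge => /negP; apply.
rewrite -[leRHS]mul1r ler_pdivlMr//; lra.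
Qed.

Lemma achievable_rate (K N amax : nat) (M R1 R2 : R) (n m b c : nat) :
  achievable K N amax M R1 R2 ->
  (forall F (S : scheme K N amax F M R1 R2),
    (1 - n%:R * worst_error S) * (2 ^ (F * n))%:R <=
    (nmsg M F ^ m * (nmsg R1 F * nmsg R2 F ^ c) ^ b)%:R) ->
  n%:R <= b%:R * (R1 + c%:R * R2) + m%:R * M.
Proof.
move=> ach cut.
(* With this error the union bound over [n] decodings loses at most half of the tuples; [n.+1] keeps
   the inverse meaningful when [n = 0]. *)
have e0 : 0 < (2 * n.+1%:R)^-1 :> R by rewrite invr_gt0 mulr_gt0// ltr0n.
have [F0 hF0] := ach _ e0.
apply: (@rate_le _ _ F0) => F F_gt0 F0F.
have [S hS] := hF0 F F_gt0 F0F.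
apply: (@le_trans _ _ ((1 - n%:R * worst_error S) * (2 ^ (F * n))%:R)).
  rewrite ler_wpM2r// lerBrDr -lerBrDl.
  apply: (@le_trans _ _ (n.+1%:R * (2 * n.+1%:R)^-1)).
    by rewrite ler_pM ?ler_nat// ?worst_error_ge0// ltW.
  by rewrite invfM mulrCA divff ?pnatr_eq0// mulr1; lra.
apply: le_trans (cut F S) _.
rewrite natrM !natrX natrM natrX.
apply: (@le_trans _ _ ((2 `^ (M * F%:R)) ^+ m *
    (2 `^ (R1 * F%:R) * (2 `^ (R2 * F%:R)) ^+ c) ^+ b)).
  have h r : (0 : R) <= (nmsg r F)%:R by rewrite ler0n.
  rewrite ler_pM ?exprn_ge0 ?mulr_ge0 ?exprn_ge0 ?lerXn2r ?nnegrE ?nmsg_le//;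
  rewrite ?mulr_ge0 ?exprn_ge0 ?powR_ge0//.
  by rewrite ler_pM ?exprn_ge0 ?lerXn2r ?nnegrE ?nmsg_le ?powR_ge0.
rewrite -!powR_mulrn ?mulr_ge0 ?powR_ge0// -!powRrM -powRD ?pnatr_eq0 ?implybT//.
rewrite -powRrM -powRD ?pnatr_eq0 ?implybT//.
by rewrite le_eqVlt; apply/orP; left; apply/eqP; congr (_ `^ _); ring.
Qed.

End Rates.

(** * Demands for distinct files and the three rate bounds *)

Section Bounds.
Variables (R : realType) (K N amax : nat) (M R1 R2 : R).
Hypothesis ach : achievable K N amax M R1 R2.

Section DistinctDemands.
Variable s : nat.
Hypotheses (s_gt0 : (0 < s)%N) (leqsK : (s <= K)%N).

Lemma demand_subproof (j : 'I_(N %/ s)) (k : 'I_K) : (j * s + k %% s < N)%N.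
Proof.
apply: (@leq_trans (j.+1 * s)); first by rewrite mulSnr ltn_add2l ltn_pmod.
by apply: leq_trans (leq_divM N s); rewrite leq_mul2r ltn_ord orbT.
Qed.

(** The [j]-th block of [s] consecutive files is requested by the first [s] users; the remainder
    modulo [s] only supplies some valid request for the other users. *)
Definition distinct_demand (j : 'I_(N %/ s)) : demand K N :=
  [ffun k => Ordinal (demand_subproof j k)].

Definition requester (i : 'I_s) : 'I_K := widen_ord leqsK i.

Lemma distinct_demand_inj :
  injective (fun p : 'I_(N %/ s) * 'I_s =>
    distinct_demand p.1 (requester p.2)).
Proof.
move=> [j i] [j' i'] /=; rewrite !ffunE => /(congr1 val) /= e.
have {}e : (j * s + i = j' * s + i')%N by move: e; rewrite !modn_small.
have ej : j = j'.
  have := congr1 (divn^~ s) e; rewrite !divnMDl//.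
  by rewrite (divn_small (ltn_ord i)) (divn_small (ltn_ord i')) !addn0 => /val_inj.
by move: e; rewrite ej => /addnI ei; congr (_, _); exact: val_inj.
Qed.

Lemma leq_distinct_cutset F (S : scheme K N amax F M R1 R2) (m c : nat)
    (A : 'I_(N %/ s) -> finType) (user : 'I_m -> 'I_K)
    (info : forall j, files N F -> A j)
    (dec : forall j, 'I_s -> 'I_(nmsg R1 F) -> A j ->
      {ffun 'I_m -> 'I_(nmsg M F)} -> 'I_(2 ^ F)) :
  (forall j i W, decoded S (distinct_demand j) W (requester i) =
    dec j i (server_signal S (distinct_demand j) W) (info j W)
      [ffun l => cache S W (user l)]) ->
  (forall j, #|A j| <= nmsg R2 F ^ c)%N ->
  (1 - (N %/ s * s)%:R * worst_error S) * (2 ^ (F * (N %/ s * s)))%:R <=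
    (nmsg M F ^ m * (nmsg R1 F * nmsg R2 F ^ c) ^ (N %/ s))%:R :> R.
Proof.
move=> decE AL.
have := @leq_cutset R K N amax F M R1 R2 S 'I_(N %/ s) 'I_s
  {ffun 'I_m -> 'I_(nmsg M F)} (fun j => ('I_(nmsg R1 F) * A j)%type)
  (nmsg R1 F * nmsg R2 F ^ c) distinct_demand requester
  (fun j W => (server_signal S (distinct_demand j) W, info j W))
  (fun W => [ffun l => cache S W (user l)])
  (fun j i x z => dec j i x.1 x.2 z) distinct_demand_inj decE.
rewrite card_ffun !card_ord; apply=> j.
by rewrite card_prod card_ord leq_mul2l AL orbT.
Qed.

Lemma all_caches_rate :
  (N %/ s * s)%:R <= (N %/ s)%:R * R1 + K%:R * M.
Proof.
suff : (N %/ s * s)%:R <= (N %/ s)%:R * (R1 + 0%:R * R2) + K%:R * M.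
  by rewrite mul0r addr0.
apply: (achievable_rate ach) => F S.
pose D j := deliver S (distinct_demand j).
(* No user signal is recorded: each received symbol is recomputed from the cache of its sender. *)
apply: (@leq_distinct_cutset F S K 0 (fun=> unit) id (fun _ _ => tt)
  (fun j i x _ z => decoder (D j) (requester i) x
    [ffun t => user_enc (D j) (sender (D j) t (group (D j) t (requester i)))
      (z (sender (D j) t (group (D j) t (requester i)))) t]
    (z (requester i)))) => [j i W|j]; last by rewrite card_unit.
rewrite /decoded ffunE; congr decoder.
by apply/ffunP => t; rewrite !ffunE.
Qed.

(** Recording one symbol per group and slot suffices for all receivers, although the senders change.
    This takes [nactive] words of [nslot] symbols, each of rate [R2]. *)
Lemma active_senders_rate :
  (N %/ s * s)%:R <= (N %/ s)%:R * (R1 + amax%:R * R2) + s%:R * M.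
Proof.
apply: (achievable_rate ach) => F S.
pose D j := deliver S (distinct_demand j).
pose A j :=
  {ffun 'I_(nslot (D j)) -> {ffun 'I_(nactive (D j)) -> 'I_(nsym (D j))}}.
apply: (@leq_distinct_cutset F S s amax A requester
  (fun j W => [ffun t => [ffun g =>
     user_signal S (distinct_demand j) W (sender (D j) t g) t]])
  (fun j i x y z => decoder (D j) (requester i) x
    [ffun t => y t (group (D j) t (requester i))] (z i))) => [j i W|j].
  rewrite /decoded ffunE; congr decoder.
  by apply/ffunP => t; rewrite !ffunE.
rewrite !card_ffun !card_ord -expnM mulnC expnM.
apply: (@leq_trans (nmsg R2 F ^ nactive (D j))).
  by rewrite leq_exp2r ?nactive_gt0 ?slot_rate.
(* Raising the exponent to [amax] needs a positive base; for base 0 the left side is 0 since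
   [nactive] is positive. *)
have [->|nmsg_gt0] := posnP (nmsg R2 F); first by rewrite exp0n ?nactive_gt0.
exact: leq_pexp2l (nactive_le (D j)).
Qed.

End DistinctDemands.

(** The received word has one symbol per slot, so it costs [R2] only once even if it comes from
    several senders. *)
Lemma single_user_rate : (0 < K)%N ->
  N%:R <= N%:R * (R1 + R2) + M.
Proof.
move=> K_gt0.
suff : (N %/ 1 * 1)%:R <= (N %/ 1)%:R * (R1 + 1%:R * R2) + 1%:R * M.
  by rewrite muln1 divn1 !mul1r.
apply: (achievable_rate ach) => F S.
pose D j := deliver S (distinct_demand (ltnSn 0) j).
apply: (@leq_distinct_cutset 1 (ltnSn 0) K_gt0 F S 1 1
  (fun j => {ffun 'I_(nslot (D j)) -> 'I_(nsym (D j))})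
  (requester K_gt0)
  (fun j W => received S (distinct_demand (ltnSn 0) j) W (requester K_gt0 ord0))
  (fun j i x y z => decoder (D j) (requester K_gt0 i) x y (z i)))
  => [j i W|j].
  by rewrite /decoded ffunE [i]ord1.
by rewrite card_ffun !card_ord expn1 slot_rate.
Qed.

End Bounds.

Theorem theorem2 (R : realType) (K N amax : nat) (M : R)
    (hK : (2 <= K)%N) (hN : (K <= N)%N)
    (ha1 : (1 <= amax)%N) (ha2 : (amax <= K %/ 2)%N)
    (hM0 : 0 <= M) (hMN : M <= N%:R) :
  (maxe (1 / 2 * (1 - M / N%:R))%:E
     (maxe
       (\big[maxe/-oo]_(1 <= s < K.+1)
          (s%:R - K%:R * M / (N %/ s)%:R)%:E)
       (\big[maxe/-oo]_(1 <= s < K.+1)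
          ((s%:R - s%:R * M / (N %/ s)%:R) * (1 / (1 + amax%:R)))%:E))
   <= optimal_delay K N amax M)%E.
Proof.
apply: le_ereal_inf_tmp => _ [R1 [R2 [ach ->]]].
have le1 : R1 <= Num.max R1 R2 by rewrite le_max lexx.
have le2 : R2 <= Num.max R1 R2 by rewrite le_max lexx orbT.
move: (Num.max R1 R2) le1 le2 => r le1 le2.
have K_gt0 : (0 < K)%N by apply: leq_trans hK.
have quo_gt0 s : (0 < s < K.+1)%N -> 0 < (N %/ s)%:R :> R.
  move=> /andP[s0 sK]; rewrite ltr0n divn_gt0//.
  exact: leq_trans hN.
rewrite !ge_max; apply/and3P; split.
- have N_gt0 : 0 < N%:R :> R by rewrite ltr0n (leq_trans K_gt0).
  have rate := single_user_rate ach K_gt0.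
  rewrite lee_fin.
  (* The factor 1/2 then comes from [R1 + R2 <= 2 r]. *)
  have : 1 - M / N%:R <= R1 + R2.
    by rewrite lerBlDr -(ler_pM2l N_gt0) mulrDr mulr1 mulrCA divff ?gt_eqF// mulr1.
  lra.
- rewrite big_nat; apply: bigmax_le => [|s sK]; first exact: leNye.
  have b_gt0 := quo_gt0 s sK; move: sK => /andP[s0 sK].
  have := all_caches_rate ach s0 sK.
  rewrite lee_fin natrM => rate; apply: le_trans le1.
  by rewrite lerBlDr -(ler_pM2l b_gt0) mulrDr mulrCA divff ?gt_eqF// mulr1.
- rewrite big_nat; apply: bigmax_le => [|s sK]; first exact: leNye.
  have b_gt0 := quo_gt0 s sK; move: sK => /andP[s0 sK].
  have := active_senders_rate ach s0 sK.
  rewrite lee_fin natrM => rate.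
  have a_gt0 : 0 < 1 + amax%:R :> R by rewrite ltr_pwDl.
  rewrite div1r ler_pdivrMr//.
  apply: (@le_trans _ _ (R1 + amax%:R * R2)).
    by rewrite lerBlDr -(ler_pM2l b_gt0) mulrDr mulrCA divff ?gt_eqF// mulr1.
  by rewrite mulrDr mulr1 [r * _]mulrC lerD// ler_wpM2l.
Qed.
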